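(* Suppose $n$ is such that $\tau=\log_2(n)$ is a positive integer. For $k\ge 0$ let $W^{(k)}=[w^{(k)}_{ij}]_{i,j=0}^{n-1}\in\mathbb{R}^{n\times n}$ be the weight matrices of the one-peer exponential graphs: $w^{(k)}_{ij}=\frac12$ if $i=j$, $w^{(k)}_{ij}=\frac12$ if $(j-i)\bmod n=2^{\,k\bmod\tau}$, and $w^{(k)}_{ij}=0$ otherwise. Then each $W^{(k)}$ is doubly stochastic, i.e. $W^{(k)}\mathbf{1}=\mathbf{1}$ and $\mathbf{1}^TW^{(k)}=\mathbf{1}^T$. Furthermore, for any integers $k\ge0$ and $\ell\ge\tau$, $$W^{(k+\ell)}W^{(k+\ell-1)}\cdots W^{(k+1)}W^{(k)}=\frac1n\mathbf{1}\mathbf{1}^T,$$ and, equivalently, $$\Big(W^{(k+\ell)}-\tfrac1n\mathbf{1}\mathbf{1}^T\Big)\Big(W^{(k+\ell-1)}-\tfrac1n\mathbf{1}\mathbf{1}^T\Big)\cdots\Big(W^{(k)}-\tfrac1n\mathbf{1}\mathbf{1}^T\Big)=0.$$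
   Context: $\mathbf{1}\in\mathbb{R}^n$ is the all-ones vector. Residues $a \bmod m$ are taken in $\{0,\dots,m-1\}$. *)

(* Defs.v *)
From mathcomp Require Import all_boot all_order all_algebra.
From mathcomp Require Import reals.

Set Implicit Arguments.
Unset Strict Implicit.
Unset Printing Implicit Defensive.

Import Order.TTheory GRing.Theory Num.Theory.
Local Open Scope ring_scope.

(* The difference j - i is taken in int (no truncation), where (_ %% n)%Z is
   the residue in {0, ..., n-1}. *)
Definition one_peer_exp (R : realType) (n tau k : nat) : 'M[R]_n :=
  \matrix_(i < n, j < n)
    if i == j then 1 / 2
    else if ((j%:Z - i%:Z) %% n%:Z)%Z == (2 ^ (k %% tau))%N%:Z then 1 / 2
    else 0.

Definition ones (R : realType) (n : nat) : 'cV[R]_n := const_mx 1.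

Definition avg_mx (R : realType) (n : nat) : 'M[R]_n :=
  (1 / n%:R) *: (ones R n *m (ones R n)^T).

(* The order matters, as the product is not commutative: this is
   A (k + l) * A (k + l - 1) * ... * A k, with l + 1 factors. *)
Definition desc_prod (R : realType) (n : nat) (A : nat -> 'M[R]_n)
    (k l : nat) : 'M[R]_n :=
  \prod_(0 <= i < l.+1) A (k + l - i)%N.

(* Main.v *)
Require Import Defs.
From mathcomp Require Import all_boot all_order all_algebra.
From mathcomp Require Import reals.

Set Implicit Arguments.
Unset Strict Implicit.
Unset Printing Implicit Defensive.

Import Order.TTheory GRing.Theory Num.Theory.
Local Open Scope ring_scope.

(** With [S] the cyclic shift, [W k = (1 + S ^ (2 ^ (k mod tau))) / 2]. These
    are polynomials in [S], hence they commute, and any [tau] consecutive ones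
    run through all residues mod [tau]. Their product is therefore
    [2^-tau * \prod_(t < tau) (1 + S ^ (2 ^ t))], that is, the average of
    [S ^ i] over [i < 2 ^ tau] by uniqueness of binary expansions, which is the
    averaging matrix [J]. The further factors are absorbed by [J W = J]; and
    [J W = W J = J J = J] makes [\prod (W - J)] equal to [\prod W - J]. *)

(** The last factor [1 + x ^+ (2 ^ t)] doubles the range of exponents: its [1] keeps those below
    [2 ^ t], its other term shifts them to the upper half. *)
Lemma prod_1DXn_pow2 (A : pzRingType) (x : A) (t : nat) :
  \prod_(0 <= i < t) (1 + x ^+ (2 ^ i)) = \sum_(0 <= i < 2 ^ t) x ^+ i.
Proof.
elim: t => [|t IHt]; first by rewrite big_geq // expn0 big_nat1 expr0.
rewrite big_nat_recr //= IHt mulrDr mulr1 expnS mul2n -addnn.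
rewrite [RHS](big_cat_nat (n := 2 ^ t)) ?leq_addr //=; congr (_ + _).
rewrite -[X in index_iota X (_ + _)]add0n big_addn addnK mulr_suml.
by apply: eq_bigr => i _; rewrite exprD.
Qed.

(** Sliding the window by one drops the factor at [k] and gains the one at [k + t]. These are equal,
    and commutativity moves one to the place of the other. *)
Lemma prod_modn_period (A : comPzRingType) (f : nat -> A) (t k : nat) :
  (0 < t)%N ->
  \prod_(k <= i < k + t) f (i %% t)%N = \prod_(0 <= i < t) f i.
Proof.
move=> t_gt0; elim: k => [|k <-].
  by apply: eq_big_nat => i /andP[_ lt_it]; rewrite modn_small.
rewrite addSn big_nat_recr ?ltnS /=; last by rewrite -addn1 leq_add2l.
by rewrite modnDr mulrC -big_ltn // -{1}(addn0 k) ltn_add2l.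
Qed.

Lemma mul_prod_absorbl (A : pzRingType) (e : A) (f : nat -> A) (m n : nat) :
  (forall i, e * f i = e) -> e * \prod_(m <= i < n) f i = e.
Proof.
move=> ef; elim/big_rec: _ => [|i x _ ex]; first by rewrite mulr1.
by rewrite mulrA ef.
Qed.

Lemma mul_prod_absorbr (A : pzRingType) (e : A) (f : nat -> A) (m n : nat) :
  (forall i, f i * e = e) -> \prod_(m <= i < n) f i * e = e.
Proof.
move=> fe; elim/big_rec: _ => [|i x _ xe]; first by rewrite mul1r.
by rewrite -mulrA xe fe.
Qed.

(** In [(P - e) * (f n - e)] the terms other than [P * f n] are [- e - e + e]. At least one factor
    is required: an empty product would give [1] against [1 - e]. *)
Lemma prod_sub_idem (A : pzRingType) (e : A) (f : nat -> A) (n : nat) :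
  e * e = e -> (forall i, e * f i = e) -> (forall i, f i * e = e) ->
  \prod_(0 <= i < n.+1) (f i - e) = \prod_(0 <= i < n.+1) f i - e.
Proof.
move=> ee ef fe; elim: n => [|n IHn]; first by rewrite !big_nat1.
rewrite big_nat_recr // IHn [in RHS]big_nat_recr //=.
by rewrite mulrBr !mulrBl ef ee (mul_prod_absorbr _ _ fe) subrr subr0.
Qed.

Section Shift.
Variables (R : realType) (m : nat).
Local Notation n := m.+1.

Definition shift_mx (a : nat) : 'M[R]_n :=
  \matrix_(i, j) (i + inZp a == j)%:R.

Lemma shift_mx0 : shift_mx 0 = 1.
Proof.
apply/matrixP=> i j; rewrite !mxE.
by rewrite (_ : inZp 0 = 0) ?addr0 //; apply: val_inj; rewrite /= mod0n.
Qed.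

Lemma shift_mxD (a b : nat) : shift_mx (a + b) = shift_mx a * shift_mx b.
Proof.
apply/matrixP=> i j; rewrite !mxE (bigD1 (i + inZp a)) //= big1 => [|h nh].
  rewrite !mxE eqxx mul1r addr0 -addrA; congr ((_ + _ == _)%:R).
  by apply: val_inj; rewrite /= modnDm.
by rewrite !mxE eq_sym (negPf nh) mul0r.
Qed.

Lemma shift_mxX (a : nat) : shift_mx a = shift_mx 1 ^+ a.
Proof.
elim: a => [|a IHa]; first by rewrite shift_mx0 expr0.
by rewrite exprS -IHa -shift_mxD.
Qed.

Lemma shift_mx_ones (a : nat) : shift_mx a *m ones R n = ones R n.
Proof.
apply/matrixP=> i j; rewrite !mxE (bigD1 (i + inZp a)) //= big1 => [|h nh].
  by rewrite !mxE eqxx mulr1 addr0.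
by rewrite !mxE eq_sym (negPf nh) mul0r.
Qed.

Lemma ones_shift_mx (a : nat) : (ones R n)^T *m shift_mx a = (ones R n)^T.
Proof.
apply/matrixP=> i j; rewrite !mxE (bigD1 (j - inZp a)) //= big1 => [|h nh].
  by rewrite !mxE subrK eqxx mulr1 addr0.
rewrite !mxE -[j in _ == j](subrK (inZp a)) (inj_eq (addIr _)) (negPf nh).
by rewrite mulr0.
Qed.

(** For each entry exactly one shift contributes, the one by [j - i] in the cyclic group of
    indices. *)
Lemma sum_shift_mx : \sum_(0 <= a < n) shift_mx a = const_mx 1.
Proof.
apply/matrixP=> i j; rewrite big_mkord summxE mxE (bigD1 (j - i)) //.
rewrite big1 => [|a na]; first by rewrite mxE valZpK addrC subrK eqxx /= addr0.
rewrite mxE valZpK; case: eqP => // ij.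
by case/eqP: na; rewrite -ij addrC addKr.
Qed.

Lemma one_peer_expE (tau k : nat) : (0 < tau)%N -> n = (2 ^ tau)%N ->
  one_peer_exp R n tau k = 2^-1 *: (1 + shift_mx 1 ^+ (2 ^ (k %% tau))).
Proof.
move=> tau_gt0 n2; rewrite -shift_mxX; set a := (2 ^ _)%N.
have a_gt0 : (0 < a)%N by rewrite expn_gt0.
have a_lt : (a < n)%N by rewrite n2 ltn_exp2l // ltn_mod.
apply/matrixP=> i j; rewrite !mxE div1r.
(* Since [a] and [j] are already reduced mod [n], both sides express the congruence of [i + a] and
   [j]. *)
have -> : (((j%:Z - i%:Z) %% n%:Z)%Z == a%:Z) = (i + inZp a == j).
  have -> : a%:Z = (a%:Z %% n%:Z)%Z by rewrite modz_nat modn_small.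
  rewrite eqz_mod_dvd -addrA -opprD -PoszD -eqz_mod_dvd eq_sym.
  rewrite !modz_nat eqz_nat (modn_small (ltn_ord j)).
  by rewrite -(inj_eq val_inj) /= modnDmr.
have [->|_] := eqVneq i j; last first.
  by case: eqP => _; rewrite ?addr0 ?add0r ?mulr1 ?mulr0.
(* On the diagonal the shift contributes nothing, because [0 < a < n] makes [inZp a] nonzero. *)
rewrite -[X in _ == X]addr0 (inj_eq (addrI _)) -(inj_eq val_inj) /=.
by rewrite modn_small // gtn_eqF // addr0 mulr1.
Qed.

Lemma one_peer_exp_ones (tau k : nat) : (0 < tau)%N -> n = (2 ^ tau)%N ->
  one_peer_exp R n tau k *m ones R n = ones R n.
Proof.
move=> t0 n2; rewrite one_peer_expE // -shift_mxX -shift_mx0 -scalemxAl mulmxDl.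
by rewrite !shift_mx_ones -mulr2n -scaler_nat scalerA mulVf ?scale1r ?pnatr_eq0.
Qed.

Lemma ones_one_peer_exp (tau k : nat) : (0 < tau)%N -> n = (2 ^ tau)%N ->
  (ones R n)^T *m one_peer_exp R n tau k = (ones R n)^T.
Proof.
move=> t0 n2; rewrite one_peer_expE // -shift_mxX -shift_mx0 -scalemxAr mulmxDr.
by rewrite !ones_shift_mx -mulr2n -scaler_nat scalerA mulVf ?scale1r ?pnatr_eq0.
Qed.

Lemma avg_mx_one_peer_exp (tau k : nat) : (0 < tau)%N -> n = (2 ^ tau)%N ->
  avg_mx R n * one_peer_exp R n tau k = avg_mx R n.
Proof.
by move=> t0 n2; rewrite -scalerAl -mulmxE -mulmxA ones_one_peer_exp.
Qed.

Lemma one_peer_exp_avg_mx (tau k : nat) : (0 < tau)%N -> n = (2 ^ tau)%N ->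
  one_peer_exp R n tau k * avg_mx R n = avg_mx R n.
Proof.
by move=> t0 n2; rewrite -scalerAr -mulmxE mulmxA one_peer_exp_ones.
Qed.

Lemma avg_mx_idem : avg_mx R n * avg_mx R n = avg_mx R n.
Proof.
apply/matrixP=> i j; rewrite !mxE big_ord1 !mxE !mulr1.
under eq_bigr do rewrite !mxE !big_ord1 !mxE !mulr1.
rewrite sumr_const card_ord -mulrnAr div1r -[X in _ * X]mulr_natr.
by rewrite mulVf ?mulr1 ?pnatr_eq0.
Qed.

Lemma desc_prod_one_peer_exp (tau k l : nat) :
  (0 < tau)%N -> n = (2 ^ tau)%N -> (tau <= l)%N ->
  desc_prod (one_peer_exp R n tau) k l = avg_mx R n.
Proof.
move=> t0 n2 le_tl.
(* The factors are lifted to polynomials in the shift, whose ring is commutative: there they may be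
   reordered, and [horner_mx] carries the result back to matrices. *)
pose q (i : nat) : {poly R} := 2^-1 *: (1 + 'X^(2 ^ i)).
have WE i : one_peer_exp R n tau i = horner_mx (shift_mx 1) (q (i %% tau)%N).
  by rewrite one_peer_expE // linearZ rmorphD rmorph1 rmorphXn /= horner_mx_X.
have qE : \prod_(0 <= i < tau) q i = n%:R^-1 *: \sum_(0 <= i < n) 'X^i.
  rewrite n2 -prod_1DXn_pow2 natrX -exprVn.
  elim: (tau) => [|t IHt]; first by rewrite !big_geq // expr0 scale1r.
  by rewrite !big_nat_recr //= IHt -scalerAl -scalerAr scalerA exprSr.
have JE : horner_mx (shift_mx 1) (\prod_(0 <= i < tau) q i) = avg_mx R n.
  rewrite qE linearZ rmorph_sum /= /avg_mx div1r; congr (_ *: _).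
  under eq_bigr do rewrite rmorphXn /= horner_mx_X -shift_mxX.
  rewrite sum_shift_mx.
  by apply/matrixP=> i j; rewrite !mxE big_ord1 !mxE mulr1.
have -> : desc_prod (one_peer_exp R n tau) k l =
    horner_mx (shift_mx 1) (\prod_(k <= i < k + l.+1) q (i %% tau)%N).
  rewrite /desc_prod; under eq_bigr do rewrite WE.
  rewrite -rmorph_prod; congr (horner_mx _ _).
  rewrite big_nat_rev /= add0n.
  rewrite -[X in index_iota X (k + _)]add0n big_addn addKn.
  apply: eq_big_nat => i /andP[_ lt_il]; congr (q (_ %% _)%N).
  by rewrite subSS -addnBA ?leq_subr // subKn // addnC.
(* The first [tau] of the [l.+1] factors already give the average; the rest are absorbed on its
   right. *)
rewrite (big_cat_nat (n := k + tau)) ?leq_addr //=; last first.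
  by rewrite leq_add2l leqW.
rewrite prod_modn_period // rmorphM /= JE rmorph_prod /=.
by apply: mul_prod_absorbl => i; rewrite -WE avg_mx_one_peer_exp.
Qed.

End Shift.

Theorem lemma1 (R : realType) (n tau : nat)
    (tau_gt0 : (0 < tau)%N) (log2_n : n = (2 ^ tau)%N) :
  (forall k : nat,
      one_peer_exp R n tau k *m ones R n = ones R n
      /\ (ones R n)^T *m one_peer_exp R n tau k = (ones R n)^T)
  /\ (forall k l : nat, (tau <= l)%N ->
        desc_prod (one_peer_exp R n tau) k l = avg_mx R n
        /\ desc_prod (fun m => one_peer_exp R n tau m - avg_mx R n) k l = 0).
Proof.
case: n log2_n => [/eqP|n n2]; first by rewrite eq_sym expn_eq0.
split=> [k|k l le_tl]; first by rewrite one_peer_exp_ones ?ones_one_peer_exp.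
have WJ := desc_prod_one_peer_exp R k tau_gt0 n2 le_tl; split=> //.
rewrite /desc_prod prod_sub_idem.
- by apply/eqP; rewrite subr_eq0; apply/eqP.
- exact: avg_mx_idem.
- by move=> i; rewrite avg_mx_one_peer_exp.
- by move=> i; rewrite one_peer_exp_avg_mx.
Qed.
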